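(* Let $T$ be a tree and let $1 \leq p < \infty$. The backward shift $B$ is bounded on $\mathbb{H}^p_0(T)$ if and only if the set $$\left\{ \frac{(K(1,n))^{p-1}\, \gamma(n+1)}{\gamma(n)} \, : \, n \in \mathbb{N}_0 \right\}$$ is bounded. In this case, $$\| B \| = \left(\sup \left\{ \frac{(K(1,n))^{p-1}\, \gamma(n+1)}{\gamma(n)} \, : \, n \in \mathbb{N}_0 \right\} \right)^{1/p}.$$
   Context: $\mathbb{N}_0=\{0,1,2,\dots\}$. A tree $T$ means a connected graph with no cycles, with countably infinitely many vertices, locally finite (every vertex has finitely many adjacent vertices), with a distinguished vertex $\mathrm{o}$ called the root. For a vertex $v$, $|v|$ is the number of edges in the unique path between $\mathrm{o}$ and $v$; $v$ is in level $n$ if $|v|=n$, and $\gamma(n)$ is the number of vertices in level $n$. For $v\neq \mathrm{o}$, $\operatorname{par}(v)$ (the parent of $v$) is the unique vertex $w$ on the path from $v$ to $\mathrm{o}$ with $|w|=|v|-1$; $\operatorname{Chi}(v)$ is the set of children of $v$, i.e. of vertices $u$ with $\operatorname{par}(u)=v$ (possibly empty). $\gamma(1,v)$ is the cardinality of $\operatorname{Chi}(v)$, and for $r\in\mathbb{N}_0$, $K(1,r):=\max\{\gamma(1,v): |v|=r\}$. $\mathcal{F}$ is the vector space of all complex-valued functions on the set of vertices of $T$. For $f\in\mathcal{F}$ and $n\in\mathbb{N}_0$, $M_p(n,f):=\left(\frac{1}{\gamma(n)}\sum_{|v|=n}|f(v)|^p\right)^{1/p}$. The little Hardy space $\mathbb{H}^p_0(T)$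 is the set of $f\in\mathcal{F}$ with $\lim_{n\to\infty}M_p(n,f)=0$; it is a Banach space with the norm $\|f\|:=\sup_{n\in\mathbb{N}_0}M_p(n,f)$. The backward shift $B:\mathcal{F}\to\mathcal{F}$ is the linear map $(Bf)(v)=\sum_{w\in\operatorname{Chi}(v)}f(w)$ (empty sums are $0$). ''$B$ is bounded on $\mathbb{H}^p_0(T)$'' means that $B$ maps $\mathbb{H}^p_0(T)$ into itself and is a bounded linear operator there; $\|B\|$ is then its operator norm. *)

(* Defs.v *)
From HB Require Import structures.
From mathcomp Require Import all_boot all_order all_algebra.
From mathcomp Require Import finmap.
From mathcomp Require Import all_classical all_reals all_analysis.
From mathcomp.real_closed Require Import complex.

Set Implicit Arguments.
Unset Strict Implicit.
Unset Printing Implicit Defensive.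

Import Order.TTheory GRing.Theory Num.Theory.
Import numFieldNormedType.Exports.

Local Open Scope classical_set_scope.
Local Open Scope ring_scope.
Local Open Scope complex_scope.

(* The vertex set is countably infinite: an infinite [countType].
   [adj_acyclic]: a duplicate-free closed walk with at most two vertices is
   not a cycle of a simple graph. *)
Record tree := Tree {
  vertex :> countType;
  adj : rel vertex;
  root : vertex;
  vertex_infinite : infinite_set [set: vertex];
  adj_sym : symmetric adj;
  adj_irr : irreflexive adj;
  adj_locally_finite : forall v, finite_set [set w | adj v w];
  adj_connected : forall v w, exists s, path adj v s /\ last v s = w;
  adj_acyclic : forall c, cycle adj c -> uniq c -> (size c <= 2)%N
}.

Section Tree.
Variable T : tree.
Implicit Types (v w : T) (n r : nat).

(* The path from [root T] to [v] is [root T :: s]. *)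
Definition simple_path_to v (s : seq T) :=
  [&& path (@adj T) (root T) s, uniq (root T :: s) & last (root T) s == v].

Lemma simple_path_ex v : exists s, simple_path_to v s.
Proof.
have [s [sp sl]] := adj_connected (root T) v.
have := sl; case/shortenP: sp => s' ps' us' _ s'v.
by exists s'; rewrite /simple_path_to ps' us' s'v eqxx.
Qed.

Lemma simple_path_inj v (s t : seq T) :
  path (@adj T) v s -> path (@adj T) v t ->
  uniq (v :: s) -> uniq (v :: t) -> last v s = last v t -> s = t.
Proof.
elim: s v t => [|a s IHs] v [|b t] //.
- move=> _ _ _ /= /andP[/negP vn _] vE.
  by case: vn; rewrite [X in X \in _]vE mem_last.
- move=> _ _ /= /andP[/negP vn _] _ vE.
  by case: vn; rewrite -[X in X \in _]vE mem_last.
have [<-{b}|ab] := eqVneq a b.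
  move=> /= /andP[_ sp] /andP[_ tp] /andP[_ su] /andP[_ tu] st.
  by rewrite (IHs a t).
move=> sp tp su tu st; exfalso.
have hs : has (mem (b :: t)) (a :: s).
  apply/hasP; exists (last a s); first exact: mem_last.
  by rewrite inE; move: st => /= ->; exact: mem_last.
move: sp su st ab hs; move es : (a :: s) => s0 sp su _ ab hs.
case: (split_find hs) es sp su => z s1 s2 zt s1t es sp su.
move: tp tu s1t zt; move et : (b :: t) => t0 tp tu s1t /= zt.
case/path.splitP: zt et tp tu s1t => t1 t2 et tp tu s1t.
have := @adj_acyclic T (v :: rcons s1 z ++ rev t1).
move: sp tp; rewrite !cat_path => /andP[sp _] /andP[tp _].
have cyc : cycle (@adj T) (v :: rcons s1 z ++ rev t1).
  rewrite /cycle rcons_cat cat_path sp last_rcons /=.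
  have := rev_path (@adj T) v (rcons t1 z).
  rewrite last_rcons belast_rcons rev_cons => ->.
  by rewrite (eq_path (e' := @adj T))// => x y; rewrite adj_sym.
have unq : uniq (v :: rcons s1 z ++ rev t1).
  move: su tu; rewrite !cons_uniq !mem_cat !cat_uniq !rcons_uniq !negb_or.
  rewrite mem_rev rev_uniq.
  case/andP=> /andP[-> _] /andP[/andP[zs1 us1] _].
  case/andP=> /andP[vt1 _] /andP[/andP[zt1 ut1] _].
  have -> : v \notin t1 by apply: contra vt1; rewrite mem_rcons inE orbC => ->.
  rewrite zs1 us1 ut1 !andbT /=; apply/hasPn => x; rewrite mem_rev => xt1.
  rewrite /= mem_rcons inE negb_or; apply/andP; split.
    by apply: contraNneq zt1 => <-.
  apply: contra s1t => xs1; apply/hasP; exists x => //.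
  by rewrite /= mem_cat mem_rcons inE xt1 orbT.
move=> /(_ cyc unq) /=; rewrite size_cat size_rcons size_rev.
case: s1 es {sp su s1t cyc unq} => // -[ae _].
case: t1 et {tp tu} => // -[be _] _.
by rewrite ae be eqxx in ab.
Qed.

Definition root_path v : seq T := xchoose (simple_path_ex v).

Lemma root_path_unique v s : simple_path_to v s -> s = root_path v.
Proof.
move=> /and3P[sp su /eqP sv].
have /and3P[tp tu /eqP tv] := xchooseP (simple_path_ex v).
by apply: (@simple_path_inj (root T)) => //; rewrite sv.
Qed.

Definition depth v : nat := size (root_path v).

Definition level n : set T := [set v | depth v = n].

(* [w] is the parent of [v]. *)
Definition is_parent v w : bool :=
  [&& v != root T, w \in root T :: root_path v & (depth w).+1 == depth v].

Definition Chi v : set T := [set u | is_parent u v].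

Lemma finite_level n : finite_set (level n).
Proof.
pose W n := [set v : T | exists s, [/\ path (@adj T) (root T) s,
  last (root T) s = v & size s = n]].
apply: (@sub_finite_set _ _ (W n)).
  move=> v <-; exists (root_path v).
  by have /and3P[? _ /eqP ?] := xchooseP (simple_path_ex v).
elim: n => [|n IHn].
  apply: (@sub_finite_set _ _ [set root T]); last exact: finite_set1.
  by move=> v [[|x s] [_ /= <- //]].
apply: (@sub_finite_set _ _ (\bigcup_(u in W n) [set w | adj u w])).
  move=> v [s]; case/lastP: s => [[]//|s x].
  rewrite rcons_path last_rcons size_rcons => -[/andP[sp sx] <- [sn]].
  by exists (last (root T) s) => //; exists s.
by apply: bigcup_finite => // u _; exact: adj_locally_finite.
Qed.

Lemma finite_Chi v : finite_set (Chi v).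
Proof.
apply: (@sub_finite_set _ _ (level (depth v).+1)); last exact: finite_level.
by move=> u /and3P[_ _ /eqP].
Qed.

(* [fset_set A] is a junk value when [A] is infinite; [finite_level] and
   [finite_Chi] ensure that this never occurs below. *)
Definition gamma n : nat := #|` fset_set (level n)|%fset.

Definition gamma1 v : nat := #|` fset_set (Chi v)|%fset.

(* Levels are nonempty, so the default value 0 of [\max] plays no role. *)
Definition K1 r : nat := (\max_(v <- fset_set (level r)) gamma1 v)%N.

End Tree.

Section Hardy.
Variables (R : realType) (T : tree).

Definition cfun : lmodType R[i] := T -> R[i]^o.

Definition Mp (p : R) (n : nat) (f : cfun) : R :=
  ((gamma T n)%:R^-1 *
     \sum_(v <- fset_set (@level T n)) (Normc.normc (f v)) `^ p) `^ p^-1.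

Definition H0 (p : R) : set cfun :=
  [set f | Mp p n f @[n --> \oo] --> (0 : R)].

(* A convergent sequence is bounded, so this real supremum is the genuine one
   for every [f] in [H0 p]. *)
Definition H0norm (p : R) (f : cfun) : R := sup (range (fun n => Mp p n f)).

Definition bshift (f : cfun) : cfun :=
  fun v => \sum_(w <- fset_set (Chi v)) f w.

Lemma bshift_is_linear : linear bshift.
Proof.
move=> a f g; apply/funext => v.
by rewrite /bshift big_split/= -scaler_sumr.
Qed.

HB.instance Definition _ :=
  GRing.isLinear.Build R[i] cfun cfun *:%R bshift bshift_is_linear.

Definition bounded_on_H0 (p : R) (A : {linear cfun -> cfun}) : Prop :=
  (forall f, H0 p f -> H0 p (A f)) /\
  exists C : R, forall f, H0 p f -> H0norm p (A f) <= C * H0norm p f.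

(* The genuine supremum as soon as [bounded_on_H0 p A]. *)
Definition opnorm (p : R) (A : {linear cfun -> cfun}) : R :=
  sup [set H0norm p (A f) | f in [set f | H0 p f /\ H0norm p f <= 1]].

Definition growth_set (p : R) : set R :=
  [set (K1 T n)%:R `^ (p - 1) * (gamma T n.+1)%:R / (gamma T n)%:R
    | n in [set: nat]].

End Hardy.

(* Main.v *)
Require Import Defs.
From mathcomp Require Import all_boot all_order all_algebra.
From mathcomp Require Import finmap.
From mathcomp Require Import all_classical all_reals all_analysis.
From mathcomp.real_closed Require Import complex.
From mathcomp Require Import ring.
Import Order.TTheory GRing.Theory Num.Theory.
Import numFieldNormedType.Exports.
Local Open Scope classical_set_scope.
Local Open Scope ring_scope.

(** Write [G n] for [K1 n `^ (p - 1) * gamma n.+1 / gamma n].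

    Upper bound.  For [v] in level [n] the sum defining [bshift f v] has at
    most [K1 n] terms, so the power mean inequality [powR_sum_le], a form of
    the convexity of [x `^ p], bounds [|bshift f v| `^ p] by
    [K1 n `^ (p - 1)] times the sum of [|f w| `^ p] over the children [w] of
    [v].  Level [n.+1] is the disjoint union of the sets of children of the
    vertices of level [n] ([sum_level_children]), so summing over [v] gives
    [Mp p n (bshift f) <= G n `^ p^-1 * Mp p n.+1 f] ([Mp_bshift_le]).  Hence
    a bound [S] on [G] makes [bshift] a bounded operator with norm at most
    [S `^ p^-1] ([bshift_bounded]).

    Lower bound.  Given [n], let [v] in level [n] have exactly [K1 n] children,
    and let [f] be the multiple of the indicator function of [Chi v] that has
    norm 1.  Then [bshift f] is nonzero at [v], and
    [Mp p n (bshift f) >= G n `^ p^-1] ([extremal_fun]).  So every bound [C] of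
    [bshift] on the unit ball satisfies [G n <= C `^ p]
    ([bounded_on_H0_growth]).

    Levels are nonempty because the tree is infinite and locally finite; this
    makes every [gamma n] and [K1 n] positive. *)

Set Implicit Arguments.
Unset Strict Implicit.

(** * Levels and children *)

Section Tree.
Context {T : tree}.
Implicit Types (v w : T) (n : nat).

Lemma root_pathP v : simple_path_to v (root_path v).
Proof. exact: xchooseP. Qed.

(** Initial segments of a root path are root paths, so the vertices on the
    root path of [v] are listed by depth. *)
Lemma depth_nth v i : (i <= depth v)%N ->
  depth (nth (Defs.root T) (Defs.root T :: root_path v) i) = i.
Proof.
move=> iv; have /and3P[sp su /eqP sv] := root_pathP v.
have it : size (take i (root_path v)) = i by rewrite size_takel.
have lt : last (Defs.root T) (take i (root_path v)) =
    nth (Defs.root T) (Defs.root T :: root_path v) i.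
  rewrite (last_nth (Defs.root T)) it -{2}(cat_take_drop i (root_path v)).
  by rewrite -cat_cons nth_cat /= it ltnSn.
rewrite -lt /depth -(@root_path_unique _ _ (take i (root_path v)))//.
rewrite /simple_path_to eqxx take_path//= take_uniq ?andbT//; last first.
  by case/andP: su.
by case/andP: su => rs _; apply: contra rs; exact: mem_take.
Qed.

Lemma mem_level v n : (v \in fset_set (@level T n)) = (depth v == n).
Proof.
rewrite in_fset_set; last exact: finite_level.
by apply/idP/eqP => [/set_mem|/mem_set].
Qed.

Lemma mem_Chi w v : (w \in fset_set (Chi v)) = is_parent w v.
Proof.
rewrite in_fset_set; last exact: finite_Chi.
by apply/idP/idP => [/set_mem|/mem_set].
Qed.

(** The parent of [v], namely the vertex preceding [v] on its root path; at
    the root the value is the root itself. *)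
Definition par v : T :=
  nth (Defs.root T) (Defs.root T :: root_path v) (depth v).-1.

Lemma depth_par v : depth (par v) = (depth v).-1.
Proof. by rewrite depth_nth// leq_pred. Qed.

Lemma is_parentE w v : (0 < depth w)%N -> is_parent w v = (v == par w).
Proof.
move=> w0; have /and3P[sp su /eqP sw] := root_pathP w.
apply/idP/eqP => [/and3P[_ vw /eqP dv]|->].
  rewrite /par -dv /= -{2}(nth_index (Defs.root T) vw) depth_nth.
    by rewrite nth_index.
  by move: vw; rewrite -index_mem.
apply/and3P; split.
- apply: contraTneq w0 => wr; rewrite lt0n negbK /depth.
  by rewrite -(@root_path_unique _ w [::])//= wr /simple_path_to /= eqxx.
- by rewrite mem_nth//= ltnS leq_pred.
- by rewrite depth_par prednK.
Qed.

Lemma is_parent_depth w v : is_parent w v -> depth w = (depth v).+1.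
Proof. by case/and3P => _ _ /eqP. Qed.

(** Every vertex of level [n.+1] is a child of exactly one vertex of level
    [n]. *)
Lemma sum_level_children (V : nmodType) n (F : T -> V) :
  \sum_(v <- fset_set (level n)) \sum_(w <- fset_set (Chi v)) F w =
  \sum_(w <- fset_set (level n.+1)) F w.
Proof.
transitivity (\sum_(w <- fset_set (@level T n.+1))
    \sum_(v <- fset_set (level n) | is_parent w v) F w).
  rewrite (exchange_big_dep xpredT)//= !big_seq; apply: eq_bigr => v.
  rewrite mem_level => /eqP vn; rewrite -[RHS]big_filter.
  apply/perm_big/uniq_perm => [||w]; rewrite ?filter_uniq ?fset_uniq//.
  rewrite mem_filter mem_Chi mem_level.
  by case: (boolP (is_parent w v)) => //= /is_parent_depth ->; rewrite vn eqxx.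
rewrite !big_seq; apply: eq_bigr => w; rewrite mem_level => /eqP wn.
rewrite -big_filter (eq_filter (a2 := pred1 (par w))); last first.
  by move=> v; rewrite is_parentE ?wn.
by rewrite filter_pred1_uniq ?fset_uniq ?big_seq1// mem_level depth_par wn.
Qed.

Lemma level_neq0 n : exists v : T, depth v = n.
Proof.
apply: contrapT => nn; apply: (@vertex_infinite T).
(* If level [n] is empty, no root path goes beyond it. *)
apply: (@sub_finite_set _ _ (\bigcup_(i in `I_n) @level T i)).
  move=> v _; exists (depth v) => //=; rewrite ltnNge; apply/negP => nv.
  apply: nn; exists (nth (Defs.root T) (Defs.root T :: root_path v) n).
  exact: depth_nth.
by apply: bigcup_finite => [|i _]; [exact: finite_II|exact: finite_level].
Qed.

Lemma gamma_gt0 n : (0 < gamma T n)%N.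
Proof.
have [v vn] := level_neq0 n; rewrite cardfs_gt0; apply/fset0Pn.
by exists v; rewrite mem_level vn.
Qed.

Lemma gamma1_le_K1 v : (gamma1 v <= K1 T (depth v))%N.
Proof. by apply: leq_bigmax_seq => //; rewrite mem_level. Qed.

Lemma K1_gt0 n : (0 < K1 T n)%N.
Proof.
have [w wn] := level_neq0 n.+1.
have dw : depth (par w) = n by rewrite depth_par wn.
rewrite -dw; apply: leq_trans (gamma1_le_K1 _); rewrite cardfs_gt0.
by apply/fset0Pn; exists w; rewrite mem_Chi is_parentE ?wn.
Qed.

Lemma K1_attained n : exists2 v : T, depth v = n & gamma1 v = K1 T n.
Proof.
apply: contrapT => nv; have := K1_gt0 n.
rewrite -ltn_predL ltnNge => /negP; apply.
apply/bigmax_leqP_seq => v; rewrite mem_level => /eqP vn _.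
rewrite -ltnS prednK ?K1_gt0// ltn_neqAle -{2}vn gamma1_le_K1 andbT.
by apply/eqP => vK; apply: nv; exists v.
Qed.

End Tree.

(** * Two inequalities for finite sums *)

Section Inequalities.
Context {R : realType}.

(** Power mean inequality.  The induction step is convexity of [x `^ p]
    applied to the new term [a] and the mean [S / m] of the [m] previous ones,
    with weights [(m + 1)^-1] and [m / (m + 1)]. *)
Lemma powR_sum_le {I : Type} (s : seq I) (F : I -> R) (p : R) :
  1 <= p -> (forall i, 0 <= F i) ->
  (\sum_(i <- s) F i) `^ p <=
  (size s)%:R `^ (p - 1) * \sum_(i <- s) F i `^ p.
Proof.
move=> p1 F0; have p0 : 0 < p by apply: lt_le_trans p1.
elim: s => [|a s IHs]; first by rewrite !big_nil powR0 ?gt_eqF// mulr0.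
have [s0|s0] := posnP (size s).
  by rewrite (size0nil s0)/= !big_seq1 powR1 mul1r.
rewrite !big_cons; set S := \sum_(i <- s) F i; rewrite -/S in IHs.
have S0 : 0 <= S by apply: sumr_ge0.
set m : R := (size s)%:R; have m0 : 0 < m by rewrite ltr0n.
have -> : ((size (a :: s))%:R : R) = m + 1 by rewrite /= -natr1.
have m10 : 0 < m + 1 by rewrite addr_gt0.
have t01 : 0 <= (m + 1)^-1 <= 1.
  by rewrite invr_ge0 ltW//= invf_le1// lerDr ltW.
have Sm0 : 0 <= S / m by rewrite divr_ge0// ltW.
have := @convex_powR R p p1 (Itv01 (andP t01).1 (andP t01).2) (F a) (S / m).
rewrite !inE /= !in_itv /= !andbT => /(_ (F0 a) Sm0).
move=> cvx; rewrite convRE [X in X `^ _ <= _]convRE /= /unstable.onem in cvx.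
have -> : F a + S = (m + 1) *
    ((m + 1)^-1 * F a + (1 - (m + 1)^-1) * (S / m)).
  by field; rewrite ?gt_eqF.
rewrite powRM ?(ltW m10)//; last first.
  by apply: addr_ge0; rewrite mulr_ge0 ?subr_ge0//; case/andP: t01.
rewrite -(mulr_powRB1 (ltW m10) p0) [(m + 1) * _]mulrC -mulrA.
rewrite ler_wpM2l ?powR_ge0//.
apply: (le_trans (ler_wpM2l (ltW m10) cvx)).
have -> : (m + 1) * ((m + 1)^-1 * F a `^ p + (1 - (m + 1)^-1) * (S / m) `^ p)
   = F a `^ p + m * (S / m) `^ p by field; rewrite ?gt_eqF.
rewrite lerD2l powRM ?invr_ge0 ?(ltW m0)//.
rewrite mulrCA -ler_pdivlMr; last first.
  by rewrite mulr_gt0// powR_gt0// invr_gt0.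
apply: (le_trans IHs); rewrite mulrC ler_wpM2l//.
  by apply: sumr_ge0 => i _; exact: powR_ge0.
rewrite -[X in _ <= X]div1r ler_pdivlMr; last first.
  by rewrite mulr_gt0// powR_gt0// invr_gt0.
rewrite -/m mulrA [_ * m]mulrC mulr_powRB1 ?(ltW m0)//.
by rewrite -powRM ?invr_ge0 ?(ltW m0)// divff ?gt_eqF// powR1.
Qed.

Lemma normc_sum {I : Type} (s : seq I) (F : I -> R[i]) :
  Normc.normc (\sum_(i <- s) F i) <= \sum_(i <- s) Normc.normc (F i).
Proof.
elim/big_rec2: _ => [|i y x _ yx]; first by rewrite Normc.normc0.
by apply: le_trans (le_normcD _ _) _; rewrite lerD2l.
Qed.

End Inequalities.

(** * The backward shift on the little Hardy space *)

(** The [n]-th member of the family whose range is [growth_set T p]. *)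
Definition growth {R : realType} (T : tree) (p : R) n : R :=
  (K1 T n)%:R `^ (p - 1) * (gamma T n.+1)%:R / (gamma T n)%:R.

Section Hardy.
Context {R : realType} {T : tree} {p : R}.
Context (p1 : 1 <= p).
Implicit Types (f : cfun R T) (n : nat) (v w : T).

Let p0 : 0 < p. Proof. exact: lt_le_trans p1. Qed.
Let pn0 : p != 0. Proof. by rewrite gt_eqF. Qed.
Let ip0 : 0 <= p^-1. Proof. by rewrite invr_ge0 ltW. Qed.

Lemma growth_ge0 n : 0 <= growth T p n.
Proof. by rewrite !mulr_ge0// ?powR_ge0// invr_ge0. Qed.

Lemma powRK (x : R) : 0 <= x -> (x `^ p) `^ p^-1 = x.
Proof. by move=> x0; rewrite -powRrM divff// powRr1. Qed.

Lemma powRVK (x : R) : 0 <= x -> (x `^ p^-1) `^ p = x.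
Proof. by move=> x0; rewrite -powRrM mulVf// powRr1. Qed.

Lemma ler_powRV (x y : R) : 0 <= x -> x <= y -> x `^ p^-1 <= y `^ p^-1.
Proof.
by move=> x0 xy; apply: ge0_ler_powR => //; rewrite nnegrE// (le_trans x0).
Qed.

Lemma powRV_le (x y : R) : 0 <= x -> x `^ p^-1 <= y -> x <= y `^ p.
Proof.
move=> x0 xy; rewrite -(powRVK x0); apply: ge0_ler_powR; rewrite ?nnegrE//.
- exact: ltW.
- exact: powR_ge0.
- exact: le_trans (powR_ge0 _ _) xy.
Qed.

Lemma normc_ge0 (z : R[i]) : 0 <= Normc.normc z.
Proof. by case: z => a b; exact: sqrtr_ge0. Qed.

Lemma Mp_ge0 n f : 0 <= Mp p n f.
Proof. exact: powR_ge0. Qed.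

(** For [f] in [H0 p] the sequence [Mp p n f] converges, hence is bounded. *)
Lemma Mp_le_H0norm n f : H0 p f -> Mp p n f <= H0norm p f.
Proof.
move=> f0; apply: ub_le_sup; last by exists n.
by apply: bounded_fun_has_ubound; apply: cvg_seq_bounded; apply: cvgP f0.
Qed.

Lemma H0norm_le f (C : R) : (forall n, Mp p n f <= C) -> H0norm p f <= C.
Proof.
move=> fC; apply: ge_sup => [|_ [n _ <-]//].
by exists (Mp p 0 f); exists 0%N.
Qed.

Lemma H0norm_ge0 f : H0 p f -> 0 <= H0norm p f.
Proof. by move=> /(Mp_le_H0norm 0); apply: le_trans (Mp_ge0 _ _). Qed.

Lemma Mp_bshift_le n f :
  Mp p n (bshift f) <= growth T p n `^ p^-1 * Mp p n.+1 f.
Proof.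
have g0 m : 0 < (gamma T m)%:R :> R by rewrite ltr0n gamma_gt0.
have N0 v : 0 <= Normc.normc (f v) `^ p by exact: powR_ge0.
rewrite -powRM ?growth_ge0//; last first.
  by rewrite mulr_ge0 ?invr_ge0 ?(ltW (g0 _)) ?sumr_ge0.
apply: ler_powRV.
  by rewrite mulr_ge0 ?invr_ge0 ?(ltW (g0 _)) ?sumr_ge0// => *; exact: powR_ge0.
have -> : growth T p n * ((gamma T n.+1)%:R^-1 *
    \sum_(v <- fset_set (level n.+1)) Normc.normc (f v) `^ p) =
  (gamma T n)%:R^-1 * ((K1 T n)%:R `^ (p - 1) *
    \sum_(v <- fset_set (@level T n.+1)) Normc.normc (f v) `^ p).
  by rewrite /growth; field; rewrite !gt_eqF.
rewrite ler_wpM2l ?invr_ge0 ?(ltW (g0 _))//.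
rewrite -sum_level_children mulr_sumr !big_seq; apply: ler_sum => v.
rewrite mem_level => /eqP vn.
apply: (@le_trans _ _ ((\sum_(w <- fset_set (Chi v)) Normc.normc (f w)) `^ p)).
  apply: ge0_ler_powR; rewrite ?nnegrE ?normc_ge0 ?(ltW p0)//.
    by apply: sumr_ge0 => w _; exact: normc_ge0.
  exact: normc_sum.
apply: (le_trans (powR_sum_le _ p1 _)) => [w|]; first exact: normc_ge0.
rewrite ler_wpM2r ?sumr_ge0// ge0_ler_powR ?nnegrE ?subr_ge0//.
by rewrite ler_nat -vn gamma1_le_K1.
Qed.

Lemma bshift_bounded (S : R) f : (forall n, growth T p n <= S) -> H0 p f ->
  H0 p (bshift f) /\ H0norm p (bshift f) <= S `^ p^-1 * H0norm p f.
Proof.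
move=> GS f0.
have le n : Mp p n (bshift f) <= S `^ p^-1 * Mp p n.+1 f.
  apply: le_trans (Mp_bshift_le n f) _.
  by rewrite ler_wpM2r ?Mp_ge0// ler_powRV ?growth_ge0.
split; last first.
  apply: H0norm_le => n; apply: le_trans (le n) _.
  by rewrite ler_wpM2l ?powR_ge0// Mp_le_H0norm.
apply: (@squeeze_cvgr _ _ _ _ (fun=> 0) (fun n => S `^ p^-1 * Mp p n.+1 f)).
- by apply: nearW => n; rewrite Mp_ge0 le.
- exact: cvg_cst.
- rewrite -[X in _ --> X](mulr0 (S `^ p^-1)); apply: cvgMr.
  by rewrite (cvg_shiftS (fun n => Mp p n f)).
Qed.

(** The indicator function of [Chi v] multiplied by the real number [c]. *)
Definition children_fun v (c : R) : cfun R T :=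
  fun w => if is_parent w v then (c%:C)%C else 0.

Lemma normc_real (c : R) : 0 <= c -> Normc.normc (c%:C)%C = c.
Proof. by move=> c0; rewrite /= expr0n addr0 sqrtr_sqr ger0_norm. Qed.

Lemma sum_Chi_cst v (c : R) :
  \sum_(w <- fset_set (Chi v)) c = (gamma1 v)%:R * c.
Proof. by rewrite big_const_seq count_predT iter_addr_0 mulr_natl. Qed.

Lemma Mp_children_fun v (c : R) m : 0 <= c -> Mp p m (children_fun v c) =
  if m == (depth v).+1
  then ((gamma T m)%:R^-1 * ((gamma1 v)%:R * c `^ p)) `^ p^-1 else 0.
Proof.
move=> c0; rewrite /Mp.
have E w : Normc.normc (children_fun v c w) `^ p =
    if is_parent w v then c `^ p else 0.
  rewrite /children_fun; case: ifP => _; first by rewrite normc_real.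
  by rewrite Normc.normc0 powR0.
rewrite (eq_bigr _ (fun w _ => E w)) -big_mkcond/=.
case: eqP => [->|mv].
  rewrite -sum_Chi_cst -big_filter; congr ((_ * _) `^ _).
  apply/perm_big/uniq_perm => [||w]; rewrite ?filter_uniq ?fset_uniq//.
  rewrite mem_filter mem_Chi mem_level.
  by case: (boolP (is_parent w v)) => //= /is_parent_depth ->; rewrite eqxx.
rewrite big_seq_cond big1 ?mulr0 ?powR0 ?invr_eq0// => w.
rewrite mem_level => /andP[/eqP wm] /is_parent_depth wv.
by case: mv; rewrite -wm.
Qed.

Lemma bshift_children_fun v (c : R) :
  bshift (children_fun v c) v = (((gamma1 v)%:R * c)%:C)%C.
Proof.
rewrite /bshift big_seq (eq_bigr (fun=> (c%:C)%C)); last first.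
  by move=> w; rewrite mem_Chi /children_fun => ->.
by rewrite -big_seq -sum_Chi_cst rmorph_sum.
Qed.

(** A function in the unit ball whose image under [bshift] is as large on level
    [n] as the upper bound [Mp_bshift_le] permits. *)
Lemma extremal_fun n : exists f, [/\ H0 p f, H0norm p f <= 1 &
  growth T p n `^ p^-1 <= Mp p n (bshift f)].
Proof.
have [v vn vK] := K1_attained (T := T) n.
have g0 m : 0 < (gamma T m)%:R :> R by rewrite ltr0n gamma_gt0.
have K0 : 0 < (K1 T n)%:R :> R by rewrite ltr0n K1_gt0.
(* The multiple [q `^ p^-1] of the indicator function of [Chi v] has norm 1. *)
set q : R := (gamma T n.+1)%:R / (K1 T n)%:R.
have q0 : 0 <= q by rewrite divr_ge0.
have c0 : 0 <= q `^ p^-1 by exact: powR_ge0.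
exists (children_fun v (q `^ p^-1)); split.
- apply: cvg_near_cst; near=> m; rewrite Mp_children_fun//.
  rewrite gtn_eqF// vn; near: m; exact: nbhs_infty_gt.
- apply: H0norm_le => m; rewrite Mp_children_fun//; case: ifP => // /eqP ->.
  rewrite powRVK// vK vn /q.
  have -> : (gamma T n.+1)%:R^-1 * ((K1 T n)%:R *
    ((gamma T n.+1)%:R / (K1 T n)%:R)) = 1 :> R by field; rewrite !gt_eqF.
  by rewrite powR1.
apply: ler_powRV; first exact: growth_ge0.
rewrite /growth mulrC ler_wpM2l ?invr_ge0//.
(* The single term at [v] already gives the bound. *)
rewrite (bigD1_seq v) ?fset_uniq ?mem_level ?vn//=.
rewrite bshift_children_fun normc_real ?mulr_ge0//.
rewrite powRM// powRVK// vK ler_wpDr//.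
  by apply: sumr_ge0 => w _; exact: powR_ge0.
rewrite -(mulr_powRB1 (ltW K0) p0) /q le_eqVlt; apply/orP; left; apply/eqP.
by field; rewrite gt_eqF.
Unshelve. all: by end_near. Qed.

Lemma bounded_growth_setP :
  bounded_set (growth_set T p) <-> exists S : R, forall n, growth T p n <= S.
Proof.
split=> [/pinfty_ex_gt0[S _ GS]|[S GS]].
  by exists S => n; apply: le_trans (ler_norm _) _; apply: GS; exists n.
exists S; split; first exact: num_real.
move=> M /ltW SM _ [n _ <-] /=; rewrite ger0_norm; last exact: growth_ge0.
exact: le_trans (GS n) SM.
Qed.

Lemma bounded_on_H0_growth (C : R) :
  (forall f, H0 p f -> H0 p (bshift f)) ->
  (forall f, H0 p f -> H0norm p f <= 1 -> H0norm p (bshift f) <= C) ->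
  forall n, growth T p n <= C `^ p.
Proof.
move=> BH BC n; have [f [f0 f1 fn]] := extremal_fun n.
apply: powRV_le; first exact: growth_ge0.
apply: le_trans fn _; apply: le_trans (BC f f0 f1).
by apply: Mp_le_H0norm; exact: BH.
Qed.

End Hardy.

Unset Implicit Arguments.
Set Strict Implicit.

Theorem theorem4p1p2 (R : realType) (T : tree) (p : R) (hp : 1 <= p) :
  (bounded_on_H0 p (@bshift R T) <-> bounded_set (growth_set T p)) /\
  (bounded_on_H0 p (@bshift R T) ->
     opnorm p (@bshift R T) = (sup (growth_set T p)) `^ p^-1).
Proof.
have boundedP : bounded_on_H0 p (@bshift R T) <-> bounded_set (growth_set T p).
  rewrite bounded_growth_setP; split=> [[BH [C BC]]|[S GS]].
    exists (`|C| `^ p); apply: bounded_on_H0_growth => // f f0 f1.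
    apply: le_trans (BC f f0) _; apply: le_trans (ler_norm _) _.
    rewrite normrM ler_piMr// ger0_norm//; exact: H0norm_ge0.
  split=> [f f0|]; first by have [] := bshift_bounded hp GS f0.
  by exists (S `^ p^-1) => f f0; have [] := bshift_bounded hp GS f0.
split=> // Bb; have [S GS] := (bounded_growth_setP).1 (boundedP.1 Bb).
have [BH _] := Bb.
have ubG : has_ubound (growth_set T p) by exists S => _ [n _ <-]; exact: GS.
have GsupG n : growth T p n <= sup (growth_set T p).
  by apply: (ub_le_sup ubG); exists n.
set N := sup (growth_set T p) `^ p^-1.
have BN f : H0 p f -> H0norm p f <= 1 -> H0norm p (@bshift R T f) <= N.
  move=> f0 f1; have [_] := bshift_bounded hp GsupG f0.
  by move/le_trans; apply; rewrite ler_piMr// powR_ge0.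
have Bop f : H0 p f -> H0norm p f <= 1 ->
    H0norm p (@bshift R T f) <= opnorm p (@bshift R T).
  move=> f0 f1; apply: ub_le_sup; last by exists f.
  by exists N => _ [g [g0 g1] <-]; exact: BN.
have [f [f0 f1 _]] := extremal_fun hp 0 (T := T).
have op0 : 0 <= opnorm p (@bshift R T).
  by apply: le_trans (Bop f f0 f1); apply: H0norm_ge0; exact: BH.
apply/eqP; rewrite eq_le; apply/andP; split.
  apply: ge_sup; first by exists (H0norm p (@bshift R T f)); exists f.
  by move=> _ [g [g0 g1] <-]; exact: BN.
rewrite -[leRHS](powRK hp)//; apply: ler_powRV => //.
  exact: le_trans (growth_ge0 0) (GsupG 0%N).
apply: ge_sup; first by exists (growth T p 0); exists 0%N.
by move=> _ [n _ <-]; exact: bounded_on_H0_growth.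
Qed.
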